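(* Let $U_i$, $i\ge1$, be an i.i.d. sequence of $\mathbb{R}$-valued random variables, and suppose that $M(\lambda)=\mathbb{E}(e^{\lambda U_1})<\infty$ for every $\lambda\in\mathbb{R}$. Let $H(\lambda)=\log M(\lambda)$ for $\lambda\in\mathbb{R}$, let $L$ be the Legendre transform of $H$, and suppose that $L$ is finite on $(0,\infty)$. Write $Y_n=\frac1n\sum_{i=1}^nU_i$ for $n\ge1$. Let $c>\mathbb{E}(U_1)$, and let $\alpha^*\in\mathbb{R}$ be the conjugate dual point of $c$, i.e. $L(c)=\sup_{\alpha\in\mathbb{R}}[\alpha c-H(\alpha)]=\alpha^*c-H(\alpha^* )$. For $\lambda>0$ and $n\ge1$ let $$R_n(\lambda)=\mathbb{E}\left[\left([\lambda(Y_n-c)+1]^+\right)^2e^{-n\alpha^*Y_n+nH(\alpha^* )}\right].$$ Then for every $\varepsilon>0$ there exists a $\gamma>0$ such that $$\sup_{\lambda\ge\gamma}\limsup_{n\to\infty}\frac1n\log R_n(\lambda)\le-2L(c)+\varepsilon.$$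
   Context: $L(\beta)=\sup_{\alpha\in\mathbb{R}}(\alpha\beta-H(\alpha))$. For real $x$, $[x]^+=\max(x,0)$. ($R_n(\lambda)$ is the second moment of the importance sampling estimator of $\mathbb{E}[\lambda(Y_n-c)+1]^+$ obtained by sampling the summands i.i.d. from $e^{\alpha^*z-H(\alpha^* )}\xi(dz)$, where $\xi$ is the law of $U_1$.) *)

(* Defs.v *)
From mathcomp Require Import all_boot all_order all_algebra finmap.
From mathcomp Require Import all_classical all_reals all_analysis.
Import Order.TTheory GRing.Theory Num.Theory.
Import numFieldNormedType.Exports.

Set Implicit Arguments.
Unset Strict Implicit.
Unset Printing Implicit Defensive.

Local Open Scope classical_set_scope.
Local Open Scope ring_scope.

(* The product rule is required of finite subfamilies only; each [B i] ranges
   over all measurable sets independently of the others. *)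
Definition mutually_independent (I : choiceType) (d d' : measure_display)
    (T : measurableType d) (T' : measurableType d') (R : realType)
    (P : probability T R) (X : I -> {RV P >-> T'}) : Prop :=
  forall (J : {fset I}) (B : I -> set T'),
    (forall i, i \in J -> measurable (B i)) ->
    P (\bigcap_(i in [set` J]) (X i @^-1` B i)) =
    (\prod_(i <- J) P (X i @^-1` B i))%E.

Definition identically_distributed (I : Type) (d d' : measure_display)
    (T : measurableType d) (T' : measurableType d') (R : realType)
    (P : probability T R) (X : I -> {RV P >-> T'}) : Prop :=
  forall (i j : I) (B : set T'), measurable B ->
    distribution P (X i) B = distribution P (X j) B.

Definition iid (I : choiceType) (d d' : measure_display)
    (T : measurableType d) (T' : measurableType d') (R : realType)
    (P : probability T R) (X : I -> {RV P >-> T'}) : Prop :=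
  mutually_independent X /\ identically_distributed X.

(* Meaningful when ['M_P X t] is finite: [fine] sends [+oo] to [0]. *)
Definition log_mgf (d : measure_display) (T : measurableType d) (R : realType)
    (P : probability T R) (X : {RV P >-> R}) (t : R) : R :=
  ln (fine ('M_P X t)).

Definition legendre (R : realType) (H : R -> R) (b : R) : \bar R :=
  ereal_sup [set (a * b - H a)%:E | a in [set: R]].

(* Sequences are indexed from [0]: [U i] stands for the usual U_(i+1), so that
   the first n variables are [U 0], ..., [U n.-1]. The value at [n = 0] is
   junk (it is [0]). *)
Definition empirical_mean (d : measure_display) (T : measurableType d)
    (R : realType) (P : probability T R) (U : nat -> {RV P >-> R}) (n : nat)
    (w : T) : R :=
  n%:R^-1 * \sum_(i < n) U i w.

Definition importance_second_moment (d : measure_display) (T : measurableType d)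
    (R : realType) (P : probability T R) (U : nat -> {RV P >-> R})
    (c astar lam : R) (n : nat) : \bar R :=
  let Y := empirical_mean U n in
  'E_P[fun w => (Num.max (lam * (Y w - c) + 1) 0) ^+ 2 *
    expR (- (n%:R * astar * Y w) + n%:R * log_mgf (U 0%N) astar)].

(* Main.v *)
Require Import Defs.
From mathcomp Require Import all_boot all_order all_algebra finmap.
From mathcomp Require Import all_classical all_reals all_analysis.
From mathcomp Require Import measurable_realfun ring lra.
Import Order.TTheory GRing.Theory Num.Theory.
Import numFieldNormedType.Exports.

(** Write [H] for the logarithmic moment generating function of [U 0] and [a]
    for the conjugate dual point of [c].  The squared positive part is
    dominated by an exponential: when [r >= 1], [max(x, 0) <= exp (r x)], hence
    [max(x, 0)^2 <= exp (2 r x)].  With [x = lam (Y - c) + 1] and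
    [r = n b / (2 lam)], which is at least [1] for all large [n] as soon as
    [b > 0], this reads
      [max(x, 0)^2 <= exp (n b (Y - c + 1 / lam))].
    Multiplying by [exp (- n a Y + n H(a))] and integrating, where independence
    turns the moment generating function of the sum into an n-th power, yields
      [R_n <= exp (n (H(b - a) + H(a) - b (c - 1 / lam)))]
    (lemma [importance_second_moment_le]), a bound with no subexponential
    prefactor.

    If [a > 0], the choice [b = 2 a] makes the rate
    [2 H(a) - 2 a c + 2 a / lam = - 2 L(c) + 2 a / lam], and a large [lam]
    finishes.  The inequality [a >= 0] comes from Jensen, [a E(U) <= H(a)]
    ([mean_le_log_mgf]), together with [a c - H(a) = L(c) >= 0] and
    [c > E(U)].  To have [b > 0] without discussing whether [a] vanishes, [b]
    is taken to be [2 a + th] with a small [th > 0]; the price is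
    [H(a + th) - H(a)], which is [O(th)] by convexity of the moment generating
    function ([log_mgf_near]).

    The product formula for expectations ([expectation_prod]) is derived from
    independence, which is a property of events, by replacing indicators with
    functions one factor at a time ([integral_factor_indic]). *)

Set Implicit Arguments.
Unset Strict Implicit.
Unset Printing Implicit Defensive.

Local Open Scope classical_set_scope.
Local Open Scope ring_scope.

(** * Expectation of a product of independent factors *)

Section expectation_of_products.
Context d d' (T : measurableType d) (T' : measurableType d') (R : realType).
Variable P : probability T R.

Import HBNNSimple.

(** Both sides are, as functions of [f], positive linear and continuous along
    nondecreasing sequences, so agreement on indicators propagates to simple
    functions and then, by monotone convergence, to all nonnegative
    measurable [f].  The weight [Z] stands for the product of the factors
    other than [f (X w)]. *)
Lemma integral_factor_indic (X : {RV P >-> T'}) (Z : T -> R) (K : R) :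
  measurable_fun setT Z -> (forall w, 0 <= Z w) -> 0 <= K ->
  (forall B, measurable B ->
    (\int[P]_w (Z w * \1_B (X w))%:E = K%:E * P (X @^-1` B))%E) ->
  forall f : T' -> R, measurable_fun setT f -> (forall x, 0 <= f x) ->
  (\int[P]_w (Z w * f (X w))%:E = K%:E * \int[P]_w (f (X w))%:E)%E.
Proof.
move=> mZ Z0 K0 ZB f mf f0.
have mX : measurable_fun setT X by [].
have mfE : measurable_fun setT (EFin \o f) by exact/measurable_EFinP.
pose h := nnsfun_approx measurableT mfE.
have hcvg x : (h n x)%:E @[n --> \oo] --> (f x)%:E.
  by apply: (cvg_nnsfun_approx measurableT mfE) => // y _; rewrite lee_fin.
have hnd x : {homo (fun n => h n x) : m n / (m <= n)%N >-> m <= n}.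
  by move=> m n mn; exact/lefP/nd_nnsfun_approx.
have mhX n : measurable_fun setT (h n \o X) by exact: measurableT_comp.
have hE n x : h n x = \sum_(y \in range (h n)) (y * \1_(h n @^-1` [set y]) x).
  exact: fimfunE.
have y0 n y x : 0 <= y * \1_(h n @^-1` [set y]) x :> R.
  by have := nnfun_muleindic_ge0 (h n) y x; rewrite -EFinM lee_fin.
have mi n y : measurable_fun setT
    (fun w => y * \1_(h n @^-1` [set y]) (X w)).
  apply: (measurableT_comp (f := fun x => y * \1_(h n @^-1` [set y]) x)) => //.
  exact: measurable_funM.
have simple n : (\int[P]_w (Z w * h n (X w))%:E
                 = K%:E * \int[P]_w (h n (X w))%:E)%E.
  transitivity (\sum_(y \in range (h n))
      \int[P]_w (Z w * (y * \1_(h n @^-1` [set y]) (X w)))%:E)%E.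
    rewrite -ge0_integral_fsum//; last 2 first.
    - by move=> y; apply/measurable_EFinP; apply: measurable_funM => //; exact: mi.
    - by move=> y w _; rewrite lee_fin mulr_ge0.
    apply: eq_integral => w _.
    by rewrite [in LHS]hE fsumEFin// mulr_fsumr.
  transitivity (K%:E * \sum_(y \in range (h n))
      \int[P]_w (y * \1_(h n @^-1` [set y]) (X w))%:E)%E; last first.
    congr (_ * _)%E; rewrite -ge0_integral_fsum//; last 2 first.
    - by move=> y; exact/measurable_EFinP.
    - by move=> y w _; rewrite lee_fin.
    by apply: eq_integral => w _; rewrite fsumEFin// -hE.
  rewrite ge0_mule_fsumr; last first.
    by move=> y; apply: integral_ge0 => w _; rewrite lee_fin.
  apply: eq_fsbigr => y /set_mem[x _ hxy].
  have yge0 : 0 <= y by rewrite -hxy.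
  have mB : measurable (h n @^-1` [set y]) by exact: measurable_funPTI.
  have -> : (\int[P]_w (Z w * (y * \1_(h n @^-1` [set y]) (X w)))%:E =
     \int[P]_w (y%:E * (Z w * \1_(h n @^-1` [set y]) (X w))%:E))%E.
    by apply: eq_integral => w _; rewrite -EFinM mulrCA.
  have mi1 : measurable_fun setT (fun w => \1_(h n @^-1` [set y]) (X w) : R).
    exact: (measurableT_comp (measurable_indic _)).
  rewrite ge0_integralZl//; last 2 first.
  - by apply/measurable_EFinP; apply: measurable_funM => //; exact: mi1.
  - by move=> w _; rewrite lee_fin mulr_ge0.
  rewrite ZB// muleCA; congr (_ * _)%E.
  under [in RHS]eq_integral do rewrite EFinM.
  rewrite ge0_integralZl//; last exact/measurable_EFinP.
  congr (_ * _)%E.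
  rewrite -[in LHS](setIT (X @^-1` _)) -integral_indic//.
  by rewrite -[X in measurable X]setTI; exact: mX.
have lhs : (K%:E * \int[P]_w (h n (X w))%:E)%E @[n --> \oo] -->
    (\int[P]_w (Z w * f (X w))%:E)%E.
  under eq_fun do rewrite -simple.
  rewrite (_ : (\int[P]_w (Z w * f (X w))%:E)%E =
      (\int[P]_w (limn (fun n => (Z w * h n (X w))%:E)))%E).
    apply: cvg_monotone_convergence => //.
    - by move=> n; apply/measurable_EFinP; apply: measurable_funM => //; exact: mhX.
    - by move=> n w _; rewrite lee_fin mulr_ge0.
    - by move=> w _ m n mn; rewrite lee_fin ler_wpM2l// hnd.
  apply: eq_integral => w _; apply/esym/cvg_lim => //.
  by rewrite EFinM; apply: (cvg_trans _ (cvgeZl _ (hcvg (X w)))).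
have rhs : (\int[P]_w (h n (X w))%:E)%E @[n --> \oo] -->
    (\int[P]_w (f (X w))%:E)%E.
  rewrite (_ : (\int[P]_w (f (X w))%:E)%E =
      (\int[P]_w (limn (fun n => (h n (X w))%:E)))%E).
    apply: cvg_monotone_convergence => //.
    - by move=> n; apply/measurable_EFinP; exact: mhX.
    - by move=> n w _; rewrite lee_fin.
    - by move=> w _ m n mn; rewrite lee_fin hnd.
  by apply: eq_integral => w _; apply/esym/cvg_lim.
by apply: (cvg_unique _ lhs) => //; exact: cvgeZl.
Qed.

Lemma mutually_independent_indic (I : choiceType) (X : I -> {RV P >-> T'})
    (B : I -> set T') (s : seq I) :
  mutually_independent X -> (forall i, measurable (B i)) -> uniq s ->
  (\int[P]_w (\prod_(i <- s) \1_(B i) (X i w))%:E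
   = \prod_(i <- s) P (X i @^-1` B i))%E.
Proof.
move=> indX mB us; pose J := [fset i in s]%fset.
have Js : perm_eq J s by apply: uniq_perm => // i; rewrite !inE.
rewrite -(perm_big _ Js)/= -indX//.
transitivity (\int[P]_w (\1_(\bigcap_(i in [set` J]) X i @^-1` B i) w)%:E)%E.
  apply: eq_integral => w _; congr (_%:E); rewrite [RHS]indicE.
  case: (boolP (w \in _)) => [/set_mem/= wB|/negP wB].
    apply: big1_seq => i /andP[_ si]; rewrite indicE mem_set//.
    by apply: wB; rewrite /= !inE.
  apply/eqP; rewrite prodf_seq_eq0; apply: contra_notT wB => /hasPn nB.
  apply/mem_set => i; rewrite /= !inE => si.
  have := nB i si; rewrite /= indicE pnatr_eq0 eqb0 negbK; exact: set_mem.
rewrite integral_indic ?setIT//; apply: fin_bigcap_measurable => // i _.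
by rewrite -[X in measurable X]setTI; apply: measurable_funPT.
Qed.

(** Independence speaks of events, so the induction must go through products in
    which part of the factors are still indicators.  Each step moves one index
    from the indicators to the functions by [integral_factor_indic]; the
    finiteness hypothesis makes the constant in that lemma a real number. *)
Lemma expectation_prod (I : choiceType) (X : I -> {RV P >-> T'})
    (f : I -> T' -> R) (s : seq I) :
  mutually_independent X ->
  (forall i, measurable_fun setT (f i)) -> (forall i x, 0 <= f i x) ->
  (forall i, \int[P]_w (f i (X i w))%:E < +oo)%E -> uniq s ->
  (\int[P]_w (\prod_(i <- s) f i (X i w))%:E
   = \prod_(i <- s) \int[P]_w (f i (X i w))%:E)%E.
Proof.
move=> indX mf f0 foo us.
have ffin i : (\int[P]_w (f i (X i w))%:E)%E \is a fin_num.
  by rewrite ge0_fin_numE// integral_ge0// => w _; rewrite lee_fin.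
(* [s] lists the factors already replaced by functions, [s2] those that are
   still indicators. *)
suff mixed s2 B : uniq (s ++ s2) -> (forall i, measurable (B i)) ->
  (\int[P]_w (\prod_(i <- s) f i (X i w)
      * \prod_(i <- s2) \1_(B i) (X i w))%:E
   = \prod_(i <- s) \int[P]_w (f i (X i w))%:E
      * \prod_(i <- s2) P (X i @^-1` B i))%E.
  have := mixed [::] (fun=> setT); rewrite cats0 !big_nil mule1 => <-//.
  by under [RHS]eq_integral do rewrite big_nil mulr1.
elim: s s2 B {us} => [|i s ih] s2 B /=.
  move=> us2 mB; rewrite big_nil mul1e -mutually_independent_indic//.
  by under [LHS]eq_integral do rewrite big_nil mul1r.
move=> /andP[ni us] mB; rewrite big_cons.
pose Z w := \prod_(j <- s) f j (X j w) * \prod_(j <- s2) \1_(B j) (X j w) : R.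
set c := (\prod_(j <- s) _)%E; set p := (\prod_(j <- s2) _)%E.
have cp_fin : (c * p)%E \is a fin_num.
  rewrite fin_numM//; first by apply: prode_fin_num.
  by apply: prode_fin_num => j _; apply: fin_num_measure; exact: measurable_funPTI.
have cp_ge0 : (0 <= c * p)%E.
  rewrite mule_ge0// prode_ge0// => j _.
  by rewrite integral_ge0// => w _; rewrite lee_fin.
transitivity (\int[P]_w (Z w * f i (X i w))%:E)%E.
  by apply: eq_integral => w _; rewrite big_cons /Z -mulrA mulrC.
rewrite (integral_factor_indic (K := fine (c * p)%E))//.
- by rewrite fineK// muleC muleA.
- apply: measurable_funM.
    by apply: measurable_prod => j _; exact: measurableT_comp.
  apply: measurable_prod => j _.
  exact: (measurableT_comp (measurable_indic _)).
- by move=> w; rewrite mulr_ge0// prodr_ge0.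
- exact: fine_ge0.
(* The factor of index [i], now an indicator, joins the list [s2]. *)
move=> B0 mB0; pose B1 j := if j == i then B0 else B j.
have B1i : B1 i = B0 by rewrite /B1 eqxx.
have B1s2 j : j \in s2 -> B1 j = B j.
  rewrite /B1; case: eqVneq => // -> is2.
  by rewrite mem_cat is2 orbT in ni.
rewrite fineK// muleAC.
transitivity (\int[P]_w (\prod_(j <- s) f j (X j w)
      * \prod_(j <- i :: s2) \1_(B1 j) (X j w))%:E)%E.
  apply: eq_integral => w _; rewrite big_cons B1i /Z mulrAC -mulrA.
  by congr (_ * (_ * _))%:E; rewrite ?B1i//; apply: eq_big_seq => j js2; rewrite B1s2.
rewrite ih.
- rewrite big_cons B1i muleA; congr (_ * _)%E.
  by apply: eq_big_seq => j js2; rewrite B1s2.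
- by rewrite (uniq_catCA s [:: i])/= ni.
- by move=> j; rewrite /B1; case: ifP.
Qed.

End expectation_of_products.

(** * The cumulant generating function *)

Section cumulant_generating_function.
Context d (T : measurableType d) (R : realType) (P : probability T R).
Variable X : {RV P >-> R}.
Hypothesis mgf_fin : forall t : R, ('M_P X t < +oo)%E.

Lemma mmt_gen_funE t : 'M_P X t = (\int[P]_w (expR (t * X w))%:E)%E.
Proof.
rewrite /mmt_gen_fun unlock; apply: eq_integral => w _ /=.
by rewrite mulrC.
Qed.

Lemma measurable_expRM t : measurable_fun setT (fun w => expR (t * X w)).
Proof. by apply: measurableT_comp => //; exact: measurable_funM. Qed.

Lemma integrable_expRM t :
  P.-integrable setT (EFin \o (fun w => expR (t * X w))).
Proof.
apply/integrableP; split.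
  by apply/measurable_EFinP; exact: measurable_expRM.
rewrite (_ : (\int[P]_w _ = 'M_P X t)%E)// mmt_gen_funE.
by apply: eq_integral => w _; rewrite /= ger0_norm// expR_ge0.
Qed.

(** [|x| <= exp x + exp (- x)], so the moment generating function at [1] and
    [-1] controls the first moment. *)
Lemma integrable_of_mgf : P.-integrable setT (EFin \o X).
Proof.
have := integrableD measurableT (integrable_expRM 1) (integrable_expRM (- 1)).
apply: le_integrable => //; first exact/measurable_EFinP.
move=> w _ /=; rewrite lee_fin mul1r mulN1r [leRHS]ger0_norm; last first.
  by rewrite addr_ge0// expR_ge0.
have := expR_ge1Dx (X w); have := expR_ge1Dx (- X w).
have := expR_gt0 (X w); have := expR_gt0 (- X w).
by case: (ler0P (X w)) => _; lra.
Qed.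

(** Jensen's inequality for the exponential, obtained by integrating the
    inequality between the exponential and its tangent at [t E(X)].  It also
    gives the positivity of the moment generating function that makes its
    logarithm meaningful. *)
Lemma expR_mean_le_mgf t :
  ((expR (t * fine ('E_P[X])%E))%:E <= 'M_P X t)%E.
Proof.
have XL : (X : T -> R) \in Lfun P 1
  by apply/Lfun1_integrable; exact: integrable_of_mgf.
set m := fine _; set e := expR _.
have mE : ('E_P[X] = m%:E)%E by rewrite fineK// expectation_fin_num.
(* [f] is the tangent line to the exponential at [t * m], evaluated at [t X]. *)
pose f w := e * (1 + t * X w - t * m).
have fE : f = cst (e * (1 - t * m)) \+ (e * t) \o* (X : T -> R).
  by apply/funext => w; rewrite /f /=; ring.
have XtL : ((e * t) \o* (X : T -> R)) \in Lfun P 1 by exact: Lfun_scale.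
have cL : (cst (e * (1 - t * m)) : T -> R) \in Lfun P 1 by exact: Lfun_cst.
have -> : (e%:E = 'E_P[f])%E.
  rewrite fE expectationD// expectation_cst expectationZl// mE -EFinM -EFinD.
  by congr (_%:E); ring.
have fL : f \in Lfun P 1 by rewrite fE rpredD.
rewrite mmt_gen_funE unlock; apply: le_integral => //.
- exact/Lfun1_integrable.
- exact: integrable_expRM.
move=> w _; rewrite lee_fin /f /e -ler_pdivlMl ?expR_gt0// -expRN -expRD.
have := expR_ge1Dx (- (t * m) + t * X w); lra.
Qed.

Lemma mmt_gen_fun_log t : 'M_P X t = (expR (log_mgf X t))%:E.
Proof.
have M0 := expR_mean_le_mgf t.
have Mf : 'M_P X t \is a fin_num.
  by rewrite ge0_fin_numE// (le_trans _ M0)// lee_fin expR_ge0.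
rewrite /log_mgf lnK ?fineK// posrE -lte_fin fineK//.
by rewrite (lt_le_trans _ M0)// lte_fin expR_gt0.
Qed.

Lemma mean_le_log_mgf t : t * fine ('E_P[X])%E <= log_mgf X t.
Proof. by have := expR_mean_le_mgf t; rewrite mmt_gen_fun_log lee_fin ler_expR. Qed.

Lemma log_mgf0 : log_mgf X 0 = 0.
Proof.
rewrite /log_mgf mmt_gen_funE.
under eq_integral do rewrite mul0r expR0.
by rewrite integral_cst//= probability_setT mule1 ln1.
Qed.

(** Convexity of the exponential between [0] and [u]: both endpoint values lie
    above the tangent at [th * u], and the stated bound is the barycentre of
    these two comparisons. *)
Lemma expR_secant (th u : R) : 0 <= th <= 1 ->
  expR (th * u) <= 1 - th + th * expR u.
Proof.
move=> /andP[th0 th1].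
have a0 : expR (th * u) * (1 - th * u) <= 1.
  rewrite -[leRHS](expRxMexpNx_1 (th * u)) ler_wpM2l ?expR_ge0//.
  by have := expR_ge1Dx (- (th * u)); lra.
have a1 : expR (th * u) * (1 + u - th * u) <= expR u.
  rewrite (_ : expR u = expR (th * u) * expR (u - th * u)); last first.
    by rewrite -expRD; congr expR; ring.
  rewrite ler_wpM2l ?expR_ge0//.
  by have := expR_ge1Dx (u - th * u); lra.
have : 0 <= (1 - th) * (1 - expR (th * u) * (1 - th * u)).
  by rewrite mulr_ge0 ?subr_ge0.
have : 0 <= th * (expR u - expR (th * u) * (1 + u - th * u)).
  by rewrite mulr_ge0 ?subr_ge0.
lra.
Qed.

(** A one-sided Lipschitz bound at [t], replacing differentiability of the
    cumulant generating function: convexity of the moment generating function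
    [M] on the segment from [t] to [t + 1] gives
    [M(t + th) <= M(t) (1 + th M(t + 1) / M(t))], and
    [ln (1 + y) <= y]. *)
Lemma log_mgf_near (t th : R) : 0 <= th <= 1 ->
  log_mgf X (t + th) <= log_mgf X t +
    th * expR (log_mgf X (t + 1) - log_mgf X t).
Proof.
move=> th01; have /andP[th0 th1] := th01.
set A := log_mgf X t; set B := log_mgf X (t + 1).
have key : expR (log_mgf X (t + th)) <= (1 - th) * expR A + th * expR B.
  rewrite -lee_fin EFinD !EFinM -!mmt_gen_fun_log !mmt_gen_funE.
  have m0 s : (0 <= expR s)%R by exact: expR_ge0.
  have mE s := (measurable_EFinP _ _).2 (measurable_expRM s).
  have scale k s : (0 <= k)%R -> (k%:E * \int[P]_w (expR (s * X w))%:E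
      = \int[P]_w (k * expR (s * X w))%:E)%E.
    move=> k0; rewrite -ge0_integralZl//; exact: mE.
  have mk k s : measurable_fun setT (fun w => (k * expR (s * X w))%:E).
    apply/measurable_EFinP; apply: measurable_funM => //.
    exact: measurable_expRM.
  rewrite !scale ?subr_ge0// -ge0_integralD//; last 2 first.
  - by move=> w _; rewrite lee_fin mulr_ge0// subr_ge0.
  - by move=> w _; rewrite lee_fin mulr_ge0.
  apply: ge0_le_integral => //.
  - exact: mE.
  - exact: emeasurable_funD.
  - move=> w _; rewrite -EFinD lee_fin mulrDl expRD.
    rewrite [(t + 1) * _]mulrDl mul1r expRD.
    have := expR_secant (X w) th01; have := expR_gt0 (t * X w); nra.
rewrite -ler_expR (le_trans key)// expRD.
rewrite (_ : expR B = expR A * expR (B - A)); last by rewrite -expRD addrC subrK.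
have := expR_ge1Dx (th * expR (B - A)); have := expR_gt0 A; nra.
Qed.

End cumulant_generating_function.

Lemma mgf_iid_sum d (T : measurableType d) (R : realType) (P : probability T R)
    (U : nat -> {RV P >-> R}) (t : R) (n : nat) :
  iid U -> (forall s : R, ('M_P (U 0%N) s < +oo)%E) ->
  (\int[P]_w (expR (t * \sum_(i < n) U i w))%:E
   = (expR (n%:R * log_mgf (U 0%N) t))%:E)%E.
Proof.
move=> [indU idU] mgf_fin.
have mE : measurable_fun setT (fun x : R => (expR (t * x))%:E).
  apply/measurable_EFinP; apply: measurableT_comp => //; exact: measurable_funM.
have E i : (\int[P]_w (expR (t * U i w))%:E = (expR (log_mgf (U 0%N) t))%:E)%E.
  rewrite -mmt_gen_fun_log// mmt_gen_funE.
  have eD j : (\int[P]_w (expR (t * U j w))%:E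
     = \int[distribution P (U j)]_x (expR (t * x))%:E)%E.
    by rewrite ge0_integral_distribution// => y; rewrite lee_fin expR_ge0.
  rewrite !eD; apply: eq_measure_integral => A mA _; exact: idU.
transitivity (\int[P]_w (\prod_(i <- index_iota 0 n) expR (t * U i w))%:E)%E.
  apply: eq_integral => w _; congr (_%:E).
  by rewrite -expR_sum -mulr_sumr big_mkord.
rewrite (expectation_prod (f := fun _ x => expR (t * x))); first last.
- exact: iota_uniq.
- by move=> i; rewrite E ltry.
- by move=> _ x; exact: expR_ge0.
- by move=> _; exact/measurable_EFinP.
- exact: indU.
under eq_bigr do rewrite E.
by rewrite prodEFin big_const_seq count_predT size_iota subn0 iter_mulr_1 expRM_natl.
Qed.

(** * The exponential bound on the second moment *)

Lemma sqr_max0_le_expR (R : realType) (a x : R) : 1 <= a ->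
  Num.max x 0 ^+ 2 <= expR (2 * a * x).
Proof.
move=> a1; case: (leP x 0) => [_|x0]; first by rewrite expr0n expR_ge0.
have -> : 2 * a * x = 2%:R * (a * x) by rewrite mulrA.
rewrite expRM_natl ler_pXn2r ?nnegrE ?expR_ge0 ?ltW//.
by have := expR_gt1Dx (x := a * x); have := expR_ge1Dx (a * x); nra.
Qed.

(** A Chernoff bound with free exponential rate [b].  The hypothesis
    [2 * lam <= n%:R * b] is what lets the positive part be dominated by the
    exponential without a constant in front. *)
Lemma importance_second_moment_le d (T : measurableType d) (R : realType)
    (P : probability T R) (U : nat -> {RV P >-> R}) (c a b lam : R) (n : nat) :
  iid U -> (forall s : R, ('M_P (U 0%N) s < +oo)%E) ->
  0 < lam -> 2 * lam <= n%:R * b ->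
  (importance_second_moment U c a lam n <=
   (expR (n%:R * (log_mgf (U 0%N) (b - a) + log_mgf (U 0%N) a
                  - b * (c - lam^-1))))%:E)%E.
Proof.
move=> iidU mgf_fin lam0 lamb; set H := log_mgf _.
have n0 : n%:R != 0 :> R.
  by apply: contraTneq lamb => ->; rewrite mul0r -ltNge mulr_gt0.
pose S w := \sum_(i < n) U i w.
have mS : measurable_fun setT S by exact: measurable_sum.
have mY : measurable_fun setT (empirical_mean U n) by exact: measurable_funM.
pose C := n%:R * (H a - b * (c - lam^-1)).
have -> : expR (n%:R * (H (b - a) + H a - b * (c - lam^-1)))
    = expR C * expR (n%:R * H (b - a)).
  by rewrite -expRD; congr expR; rewrite /C; ring.
rewrite EFinM -mgf_iid_sum// -ge0_integralZl//; last first.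
  by apply/measurable_EFinP; apply: measurableT_comp => //; exact: measurable_funM.
rewrite /importance_second_moment unlock; apply: ge0_le_integral => //.
- by move=> w _; rewrite lee_fin mulr_ge0 ?sqr_ge0 ?expR_ge0.
- apply/measurable_EFinP; apply: measurable_funM.
    apply: measurable_funX; apply: measurable_maxr => //.
    by apply: measurable_funD => //; apply: measurable_funM => //; exact: measurable_funB.
  apply: measurableT_comp => //; apply: measurable_funD => //.
  by apply: measurableT_comp => //; exact: measurable_funM.
- apply/measurable_EFinP; apply: measurable_funM => //.
  by apply: measurableT_comp => //; exact: measurable_funM.
move=> w _; rewrite -EFinM lee_fin -/(S w) -/H.
set y := empirical_mean U n w.
have Sy : S w = n%:R * y by rewrite /y /empirical_mean mulrA divff// mul1r.
have rate1 : 1 <= n%:R * b / (2 * lam) by rewrite ler_pdivlMr ?mul1r ?mulr_gt0.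
apply: (le_trans (ler_wpM2r (expR_ge0 _) (sqr_max0_le_expR _ rate1))).
rewrite -!expRD ler_expR le_eqVlt; apply/orP; left; apply/eqP.
rewrite Sy /C; field; exact: lt0r_neq0.
Qed.

(** * The logarithmic rate of the second moment *)

Theorem theorem4p2 (d : measure_display) (T : measurableType d) (R : realType)
    (P : probability T R) (U : nat -> {RV P >-> R})
    (hU : iid U)
    (hM : forall t : R, ('M_P (U 0%N) t < +oo)%E)
    (hL : forall b : R, 0 < b -> legendre (log_mgf (U 0%N)) b \is a fin_num)
    (c : R) (hc : ('E_P[U 0%N] < c%:E)%E)
    (astar : R)
    (hastar : legendre (log_mgf (U 0%N)) c =
              (astar * c - log_mgf (U 0%N) astar)%:E) :
  forall eps : R, 0 < eps ->
  exists gamma : R, 0 < gamma /\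
    (ereal_sup
       [set limn_esup (fun n : nat =>
              (n%:R^-1)%:E * lne (importance_second_moment U c astar lam n))
       | lam in [set lam : R | (gamma <= lam)%R]]
     <= (- 2)%:E * legendre (log_mgf (U 0%N)) c + eps%:E)%E.
Proof.

move=> eps eps0; set H := log_mgf (U 0%N) in hL hastar *.
have [m mE] : exists m, ('E_P[U 0%N] = m%:E)%E.
  exists (fine ('E_P[U 0%N])%E); rewrite fineK//; apply: expectation_fin_num.
  by apply/Lfun1_integrable; exact: integrable_of_mgf.
have mc : m < c by rewrite -lte_fin -mE.
have astar0 : 0 <= astar.
  have L0 : 0 <= astar * c - H astar.
    rewrite -lee_fin -hastar; apply: ereal_sup_ubound; exists 0 => //.
    by rewrite mul0r /H log_mgf0 subr0.
  have Hm : astar * m <= H astar by have := mean_le_log_mgf hM astar; rewrite mE.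
  have : 0 <= astar * (c - m) by lra.
  by rewrite pmulr_lge0 // subr_gt0.
pose K := expR (H (astar + 1) - H astar).
have Kc0 : 0 < K + `|c| by rewrite ltr_wpDr ?expR_gt0.
(* [th] makes the perturbation [th * (K - c)] at most [eps / 2]. *)
pose th := Num.min 1 (eps / 2 / (K + `|c|)).
have th0 : 0 < th by rewrite lt_min ltr01 !divr_gt0.
have th1 : th <= 1 by rewrite ge_min lexx.
have Hth : H (astar + th) - th * c <= H astar + eps / 2.
  have th01 : 0 <= th <= 1 by rewrite ltW.
  have thK : th * (K + `|c|) <= eps / 2.
    by rewrite -ler_pdivlMr// ge_min lexx orbT.
  have := log_mgf_near hM astar th01; rewrite -/H -/K.
  have := ler_norm (- c); rewrite normrN; nra.
pose b := 2 * astar + th.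
have b0 : 0 < b by rewrite /b; lra.
(* This threshold ensures [b / lam <= eps / 2], since [b <= 2 * astar + 1]. *)
exists (2 * (2 * astar + 1) / eps); split; first by rewrite divr_gt0//; lra.
apply/ereal_supP => _ [lam /= lam_ge <-].
have lam0 : 0 < lam by apply: lt_le_trans lam_ge; rewrite divr_gt0//; lra.
have blam : b / lam <= eps / 2.
  rewrite ler_pdivrMr//; move: lam_ge; rewrite ler_pdivrMr// /b; lra.
(* From this rank on, [2 * lam <= n * b]; it also excludes [n = 0]. *)
have [N _ HN] := nbhs_infty_ger (2 * lam / b).
apply: ge_ereal_inf; exists (ereal_sup [set (n%:R^-1)%:E *
    lne (importance_second_moment U c astar lam n) | n in [set n | (N <= n)%N]])%E.
  by exists [set n | (N <= n)%N] => //; exists N.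
apply/ereal_supP => _ [n /= Nn <-].
have lamb : 2 * lam <= n%:R * b by rewrite -ler_pdivrMr//; exact: HN.
have n0 : 0 < n%:R :> R.
  by rewrite -(pmulr_lgt0 _ b0); apply: lt_le_trans lamb; rewrite mulr_gt0.
have Rn := importance_second_moment_le c astar hU hM lam0 lamb.
rewrite hastar -EFinM -EFinD -/H in Rn *.
rewrite (_ : b - astar = astar + th) in Rn; last by rewrite /b; lra.
set E := (_ - b * _) in Rn.
have E_le : E <= - 2 * (astar * c - H astar) + eps.
  by rewrite /E /b mulrBr -/b; move: Hth blam; rewrite /b; lra.
apply: (@le_trans _ _ E%:E); last by rewrite lee_fin.
rewrite lee_pdivrMl// -EFinM -[X in (_ <= X%:E)%E]expRK -lne_EFin ?expR_gt0//.
rewrite lee_lne// in_itv/= leey andbT ?lee_fin ?expR_ge0//.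
by apply: expectation_ge0 => w; rewrite mulr_ge0 ?sqr_ge0 ?expR_ge0.
Qed.
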